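(* Let $M=(M_p)_{p\in\mathbb{N}}\in\mathcal{LC}$ be given. The following conditions are equivalent: (i) There exist $L\in\mathbb{N}_{>0}$, $h>1$ and $A\ge 1$ such that for all $p\in\mathbb{N}$: $(M_p)^L h^{Lp}\le A\,M_{Lp}$; i.e. (equivalently) there exists $L\in\mathbb{N}_{>0}$ such that $$\liminf_{p\to+\infty}\frac{(M_{Lp})^{1/(Lp)}}{(M_p)^{1/p}}>1.$$ (ii) There exists $h>1$ such that $\omega_M(ht)=O(\omega_M(t))$ as $t\to+\infty$; respectively, equivalently, there exist $h>1$ and $L'\ge 1$ such that $\omega_M(ht)\le L'\omega_M(t)+L'$ for all $t\ge 0$. (iii) $\omega_M$ satisfies $(\omega_1)$, i.e. $\omega_M(2t)=O(\omega_M(t))$ as $t\to+\infty$. Moreover, any $L$ as in the first formulation of (i) necessarily satisfies $L\ge 2$, and the first formulation of (i) and (ii) hold true for the same $h>1$ (i.e. for each fixed $h>1$, (i) holds with this $h$ if and only if (ii) holds with this $h$).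
   Context: Notation: $\mathbb{N}=\{0,1,2,\dots\}$, $\mathbb{N}_{>0}=\{1,2,3,\dots\}$. $\mathcal{LC}$ denotes the set of all sequences $M=(M_p)_{p\in\mathbb{N}}$ of positive reals that are normalized ($1=M_0\le M_1$), log-convex ($M_p^2\le M_{p-1}M_{p+1}$ for all $p\ge 1$) and satisfy $\lim_{p\to+\infty}(M_p)^{1/p}=+\infty$. The associated weight function of $M$ is $\omega_M:[0,+\infty)\to[0,+\infty)$, $\omega_M(t):=\sup_{p\in\mathbb{N}}\log\left(\frac{t^p}{M_p}\right)$ for $t>0$, $\omega_M(0):=0$. *)

(* Defs.v *)
From HB Require Import structures.
From mathcomp Require Import all_boot all_order all_algebra.
From mathcomp Require Import all_classical all_reals all_analysis.

Set Implicit Arguments.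
Unset Strict Implicit.
Unset Printing Implicit Defensive.

Import Order.TTheory GRing.Theory Num.Theory.
Import numFieldNormedType.Exports.

Local Open Scope classical_set_scope.
Local Open Scope ring_scope.

Definition LC {R : realType} (M : nat -> R) : Prop :=
  [/\ forall p, 0 < M p,
      M 0%N = 1 /\ 1 <= M 1%N,
      forall p, (1 <= p)%N -> M p ^+ 2 <= M p.-1 * M p.+1
    & M p `^ (p%:R^-1) @[p --> \oo] --> +oo].

(* Only the values at [t >= 0] are meaningful. The real supremum [sup] is a
   genuine one when [M] is in LC, by [LC_has_sup] below. *)
Definition omega {R : realType} (M : nat -> R) (t : R) : R :=
  if 0 < t then sup (range (fun p : nat => ln (t ^+ p / M p))) else 0.

Lemma LC_has_sup {R : realType} (M : nat -> R) (t : R) : LC M -> 0 < t ->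
  has_sup (range (fun p : nat => ln (t ^+ p / M p))).
Proof.
move=> [M0 _ _ /cvgryPge/(_ t)[N _ HN]] t0.
split; first by exists (ln (t ^+ 0 / M 0%N)), 0%N.
exists (\sum_(i < N.+1) `|ln (t ^+ i / M i)|) => _ [p _ <-].
have [pN|Np] := ltnP p N.+1.
  rewrite (bigD1 (Ordinal pN)) //= (le_trans (ler_norm _)) // lerDl.
  exact: sumr_ge0.
apply: (@le_trans _ _ 0); last exact: sumr_ge0.
apply: ln_le0; rewrite ler_pdivrMr // mul1r.
have p0 : p%:R != 0 :> R by rewrite pnatr_eq0 -lt0n (leq_ltn_trans _ Np).
have /= tM := HN _ (ltnW Np).
have := @lerXn2r _ p t (M p `^ p%:R^-1).
rewrite !nnegrE powR_ge0 (ltW t0) => /(_ isT isT tM).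
by rewrite -[_ `^ _ ^+ p]powR_mulrn ?powR_ge0// -powRrM mulVf// powRr1// ltW.
Qed.

(* [=O_F] needs a [filter_on] structure on [F]; landau.v has none for +oo. *)
Canonical pinfty_filter_on {R : numFieldType} : filter_on R :=
  FilterType (pinfty_nbhs R) (@filter_filter _ _ proper_pinfty_nbhs).

Definition dilation_bigO {R : realType} (f : R -> R) (h : R) : Prop :=
  (fun t : R => f (h * t)) =O_+oo f.

Definition omega1 {R : realType} (f : R -> R) : Prop := dilation_bigO f 2.

Definition dilation_le {R : realType} (f : R -> R) (h : R) : Prop :=
  exists2 L' : R, 1 <= L' & forall t : R, 0 <= t -> f (h * t) <= L' * f t + L'.

Definition root_growth {R : realType} (M : nat -> R) (L : nat) (h : R) : Prop :=
  exists2 A : R, 1 <= A &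
    forall p : nat, M p ^+ L * h ^+ (L * p) <= A * M (L * p)%N.

(* The term of index [p = 0] is irrelevant to the lower limit, which is taken
   in the extended reals. *)
Definition root_liminf {R : realType} (M : nat -> R) (L : nat) : \bar R :=
  limn_einf (fun p : nat =>
    (M (L * p)%N `^ ((L * p)%:R^-1) / M p `^ (p%:R^-1))%:E).

(* Main.v *)
(** From [M_p^L h^(Lp) <= A M_(Lp)], the supremum defining [omega (h t)] is
    bounded on the indices [L p] by [L omega t + ln A], and hence, by
    monotonicity of [M], everywhere up to [L ln (h t) = O(omega t)].
    Conversely, log-convexity gives [M_p = sup_t t^p / exp (omega t)], attained
    at [t = M_(p+1) / M_p]; inserting [omega (h t) <= L omega t + L] there
    yields the growth condition with the same [h] and [A = exp L].
    Iterating the dilation estimate passes from any [h > 1] to [2]. *)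
Require Import Defs.
From mathcomp Require Import all_boot all_order all_algebra.
From mathcomp Require Import all_classical all_reals all_analysis.
From mathcomp Require Import ring lra.
Set Implicit Arguments.
Unset Strict Implicit.
Import Order.TTheory GRing.Theory Num.Theory.
Import numFieldNormedType.Exports.
Local Open Scope classical_set_scope.
Local Open Scope ring_scope.

(** * Roots, unbounded powers and lower limits *)

Lemma powR_invn_expn (R : realType) (x : R) (n : nat) :
  0 <= x -> (0 < n)%N -> (x `^ n%:R^-1) ^+ n = x.
Proof.
move=> x0 n0; rewrite -powR_mulrn ?powR_ge0// -powRrM mulVf ?powRr1//.
by rewrite pnatr_eq0 -lt0n.
Qed.

Lemma expn_unbounded (R : realType) (q A : R) :
  1 < q -> exists N : nat, forall n, (N <= n)%N -> A <= q ^+ n.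
Proof.
move=> q1; have lq : 0 < ln q by rewrite ln_gt0.
exists (Num.bound (A / ln q)) => n Nn.
rewrite -[q]lnK ?posrE ?(lt_trans ltr01)// -expRM_natr.
apply: (le_trans _ (expR_ge1Dx _)); apply: (@le_trans _ _ (ln q * n%:R)).
  rewrite mulrC -ler_pdivrMr//; apply: (le_trans (ltW (unstable.ltr_bound _))).
  by rewrite ler_nat.
by rewrite lerDr.
Qed.

(** The lower limit is the supremum of the tail infima, so it exceeds [c] exactly when one of them
    does. The bound [h] must be uniform: [c < u p] for all large [p] still allows the lower limit
    [c]. *)
Lemma limn_einf_gtP (R : realType) (u : nat -> R) (c : R) :
  (c%:E < limn_einf (fun p => (u p)%:E))%E <->
  exists2 h, c < h & \forall p \near \oo, h <= u p.
Proof.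
rewrite limn_einf_lim (cvg_lim _ (@cvg_einfs_sup _ _))//; split.
  move=> /ereal_sup_gt[_ [N _ <-]] cN.
  have inf_le p : (N <= p)%N -> (einfs (EFin \o u) N <= (u p)%:E)%E.
    by move=> Np; apply: (@ereal_inf_lbound _ (sdrop _ N)); exists p.
  case e : (einfs (EFin \o u) N) => [h| |].
  - exists h; first by move: cN; rewrite -[einfs _ N]/(einfs (EFin \o u) N) e lte_fin.
    by exists N => // p /inf_le; rewrite e lee_fin.
  - by have := inf_le N (leqnn N); rewrite e.
  - by move: cN; rewrite -[einfs _ N]/(einfs (EFin \o u) N) e.
move=> [h ch [N _ hu]].
apply: (@lt_le_trans _ _ h%:E); first by rewrite lte_fin.
apply: (@le_trans _ _ (einfs (fun p => (u p)%:E) N)).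
  apply: le_ereal_inf_tmp => _ [p /= Np <-].
  by rewrite lee_fin; exact: hu.
by apply: ereal_sup_ubound; exists N.
Qed.

(** * Log-convex sequences and their quotients *)

Lemma LC_gt0 (R : realType) (M : nat -> R) (p : nat) : LC M -> 0 < M p.
Proof. by case. Qed.

Lemma LC_quotient_nondecreasing (R : realType) (M : nat -> R) (p q : nat) :
  LC M -> (p <= q)%N -> M p.+1 / M p <= M q.+1 / M q.
Proof.
move=> [M0 _ Mlc _].
apply: ((nondecreasing_seqP (fun k => M k.+1 / M k)).1 _ p q) => {p q}p.
rewrite ler_pdivrMr// mulrAC ler_pdivlMr// -expr2 mulrC.
exact: Mlc p.+1 _.
Qed.

(** The first quotient is [M 1 >= 1], and the quotients increase. *)
Lemma LC_nondecreasing (R : realType) (M : nat -> R) (p q : nat) :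
  LC M -> (p <= q)%N -> M p <= M q.
Proof.
move=> hM; apply: ((nondecreasing_seqP M).1 _ p q) => {p q}p.
have [M0 [M01 M1] _ _] := hM.
have := @LC_quotient_nondecreasing _ _ 0 p hM (leq0n p).
rewrite M01 divr1 => /(le_trans M1).
by rewrite ler_pdivlMr// mul1r.
Qed.

Lemma LC_ge1 (R : realType) (M : nat -> R) (p : nat) : LC M -> 1 <= M p.
Proof.
by move=> hM; case: (hM) => _ [<- _] _ _; apply: LC_nondecreasing.
Qed.

(* The maximum of [t ^+ q / M q] over [q] is attained at [q = p] when [t] is
   the quotient [M p.+1 / M p]. *)
Lemma LC_quotient_max (R : realType) (M : nat -> R) (p q : nat) : LC M ->
  (M p.+1 / M p) ^+ q / M q <= (M p.+1 / M p) ^+ p / M p.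
Proof.
move=> hM; have M0 k := @LC_gt0 _ M k hM.
have t0 : 0 < M p.+1 / M p by rewrite divr_gt0.
pose a q := (M p.+1 / M p) ^+ q / M q.
(* Each step multiplies the term by [t] over the [k]-th quotient. This factor is at least 1 for
   [k <= p] and at most 1 for [k >= p], so the terms rise up to [p] and fall afterwards. *)
have aS k : a k.+1 = a k * (M p.+1 / M p / (M k.+1 / M k)).
  by rewrite /a exprS; set t := M p.+1 / M p; field; rewrite !gt_eqF.
have a0 k : 0 <= a k by rewrite divr_ge0 ?exprn_ge0 ?ltW.
rewrite -/(a q) -/(a p); have [pq|/ltnW qp] := leqP p q.
  rewrite -(subnKC pq); elim: (q - p)%N => [|k IH]; first by rewrite addn0.
  apply: le_trans IH; rewrite addnS aS ler_piMr// ler_pdivrMr ?divr_gt0// mul1r.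
  by apply: LC_quotient_nondecreasing; rewrite ?leq_addr.
rewrite -(subKn qp); have := leq_subr q p.
elim: (p - q)%N => [|k IH kp]; first by rewrite subn0.
apply: le_trans (IH (ltnW kp)); rewrite -(subnSK kp) aS ler_peMr//.
rewrite ler_pdivlMr ?divr_gt0// mul1r.
by apply: LC_quotient_nondecreasing; rewrite ?leq_subr.
Qed.

(** * The associated weight function *)

(** Exponentiating trades the supremum of logarithms for a family of power bounds; later estimates
    of [omega] use this form. *)
Lemma omega_le (R : realType) (M : nat -> R) (t x : R) : LC M -> 0 < t ->
  omega M t <= x <-> forall p, t ^+ p <= expR x * M p.
Proof.
move=> hM t0; have M0 k := @LC_gt0 _ M k hM; rewrite /omega t0.
have lnE p : (ln (t ^+ p / M p) <= x) = (t ^+ p <= expR x * M p).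
  rewrite -ler_pdivrMr// -[in LHS](expRK x) ler_ln// posrE ?expR_gt0//.
  by rewrite divr_gt0 ?exprn_gt0.
split=> [tx p|tx].
  rewrite -lnE; apply: le_trans tx; apply: ub_le_sup; last by exists p.
  by have [] := LC_has_sup hM t0.
apply: ge_sup; first by have [] := LC_has_sup hM t0.
by move=> _ [p _ <-]; rewrite lnE.
Qed.

Lemma expr_le_omega (R : realType) (M : nat -> R) (t : R) (p : nat) :
  LC M -> 0 < t -> t ^+ p <= expR (omega M t) * M p.
Proof. by move=> hM t0; apply: (omega_le _ hM t0).1. Qed.

Lemma omega_ge0 (R : realType) (M : nat -> R) (t : R) : LC M -> 0 <= omega M t.
Proof.
move=> hM; have [t0|] := boolP (0 < t); last by rewrite /omega => /negbTE->.
have := @expr_le_omega _ M t 0 hM t0.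
by case: (hM) => _ [-> _] _ _; rewrite expr0 mulr1 -expR0 ler_expR.
Qed.

Lemma omega_le_mono (R : realType) (M : nat -> R) (s t : R) :
  LC M -> s <= t -> omega M s <= omega M t.
Proof.
move=> hM st; have [s0|] := boolP (0 < s); last first.
  by rewrite {1}/omega => /negbTE->; apply: omega_ge0.
have t0 := lt_le_trans s0 st; apply/omega_le => // p.
apply: le_trans (expr_le_omega p hM t0).
by rewrite lerXn2r// nnegrE ltW.
Qed.

Lemma omega_le1 (R : realType) (M : nat -> R) (t : R) :
  LC M -> t <= 1 -> omega M t = 0.
Proof.
move=> hM t1; apply/eqP; rewrite eq_le omega_ge0// andbT.
have [t0|] := boolP (0 < t); last by rewrite /omega => /negbTE->.
apply/omega_le => // p; rewrite expR0 mul1r.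
apply: le_trans (LC_ge1 p hM); exact: exprn_ile1 (ltW t0) t1.
Qed.

(** * The growth condition and its lower-limit form *)

(** For [L = 1] the factor [M p] cancels and leaves [h ^+ p <= A] for all [p], which is absurd for
    [h > 1]. *)
Lemma root_growth_ge2 (R : realType) (M : nat -> R) (L : nat) (h : R) : LC M ->
  (0 < L)%N -> 1 < h -> root_growth M L h -> (2 <= L)%N.
Proof.
move=> hM; case: L => [//|[|//]] _ h1 [A _ hA].
have [N /(_ N (leqnn N))] := expn_unbounded (A + 1) h1.
rewrite leNgt => /negP[]; apply: (@le_lt_trans _ _ A); last by rewrite ltrDl.
by have := hA N; rewrite mul1n expr1 mulrC ler_pM2r// LC_gt0.
Qed.

Lemma root_quotient_ge (R : realType) (M : nat -> R) (L p : nat) (h : R) :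
  LC M -> 0 <= h -> (0 < L)%N -> (0 < p)%N ->
  (h <= M (L * p)%N `^ ((L * p)%:R^-1) / M p `^ (p%:R^-1)) =
  (M p ^+ L * h ^+ (L * p) <= M (L * p)%N).
Proof.
move=> hM h0 L0 p0; have M0 k := @LC_gt0 _ M k hM.
have Lp0 : (0 < L * p)%N by rewrite muln_gt0 L0.
rewrite ler_pdivlMr ?powR_gt0// -(ler_pXn2r Lp0) ?nnegrE ?powR_ge0//; last first.
  by rewrite mulr_ge0 ?powR_ge0.
rewrite powR_invn_expn ?(ltW (M0 _))// exprMn mulnC [X in _ * X]exprM.
by rewrite powR_invn_expn ?(ltW (M0 _))// mulrC.
Qed.

Lemma root_growth_liminf (R : realType) (M : nat -> R) (L : nat) (h : R) :
  LC M -> (0 < L)%N -> 1 < h -> root_growth M L h ->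
  (1%:E < root_liminf M L)%E.
Proof.
move=> hM L0 h1 [A A1 hA]; have M0 k := @LC_gt0 _ M k hM.
(* Lowering [h] to some [g > 1] gains the factor [(h / g) ^+ (L * p)], which eventually absorbs
   [A]. *)
have [g /andP[g1 gh]] : exists g, 1 < g < h by exists ((1 + h) / 2); lra.
have g0 : 0 < g := lt_trans ltr01 g1.
have [N hN] : exists N, forall n, (N <= n)%N -> A <= (h / g) ^+ n.
  by apply: expn_unbounded; rewrite ltr_pdivlMr// mul1r.
apply/limn_einf_gtP; exists g => //; exists N.+1 => // p /= Np.
rewrite root_quotient_ge ?(ltW g0) ?(leq_trans _ Np)//.
have A0 : 0 < A by apply: lt_le_trans A1.
rewrite -(ler_pM2l A0); apply: le_trans (hA p).
rewrite mulrCA ler_pM2l ?exprn_gt0//.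
rewrite -ler_pdivlMr ?exprn_gt0// -expr_div_n; apply: hN.
by rewrite (leq_trans (ltnW Np))// leq_pmull.
Qed.

Lemma liminf_root_growth (R : realType) (M : nat -> R) (L : nat) :
  LC M -> (0 < L)%N -> (1%:E < root_liminf M L)%E ->
  exists2 h : R, 1 < h & root_growth M L h.
Proof.
move=> hM L0 /limn_einf_gtP[h h1 [N _ hN]]; exists h => //.
have M0 k := @LC_gt0 _ M k hM; have h0 := lt_trans ltr01 h1.
pose b p := M p ^+ L * h ^+ (L * p).
have b0 p : 0 <= b p by rewrite mulr_ge0 ?exprn_ge0// ltW.
(* The sum covers the indices [p <= N], where [M (L * p) >= 1] suffices; the summand 1 covers the
   rest. *)
exists (1 + \sum_(i < N.+1) b i); first by rewrite lerDl sumr_ge0.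
move=> p; rewrite -/(b p); have [pN|Np] := ltnP p N.+1.
  apply: (@le_trans _ _ (1 + \sum_(i < N.+1) b i)).
    rewrite (bigD1 (Ordinal pN)) //= addrCA lerDl addr_ge0//.
    by rewrite sumr_ge0.
  by rewrite ler_peMr ?LC_ge1// addr_ge0// sumr_ge0.
apply: (@le_trans _ _ (M (L * p)%N)).
  have := hN p (ltnW Np).
  by rewrite root_quotient_ge ?(ltW h0)// (leq_ltn_trans _ Np).
by rewrite ler_peMl ?(ltW (M0 _))// lerDl sumr_ge0.
Qed.

(** * Growth condition and dilation estimate with the same [h] *)

(* Indices [q = L p + r] with [r < L] cost a factor [(h t)^L], which is
   absorbed by [t <= expR (omega t) * M 1]; this keeps [h] unchanged. *)
Lemma root_growth_dilation (R : realType) (M : nat -> R) (L : nat) (h : R) :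
  LC M -> (0 < L)%N -> 1 < h -> root_growth M L h -> dilation_le (omega M) h.
Proof.
move=> hM L0 h1 [A A1 hA]; have M0 k := @LC_gt0 _ M k hM.
have h0 := lt_trans ltr01 h1; have A0 := lt_le_trans ltr01 A1.
(* [A] comes from the multiple of [L], the other two factors from the remainder. *)
pose B := A * h ^+ L * M 1 ^+ L.
have B1 : 1 <= B.
  by do !apply: mulr_ege1 => //; apply: exprn_ege1; [exact: ltW|exact: LC_ge1].
have B0 := lt_le_trans ltr01 B1.
have lB : 0 <= ln B by apply: ln_ge0.
have L1 : 1 <= L%:R :> R by rewrite ler1n.
exists ((2 * L)%:R + ln B); first by rewrite natrM; lra.
move=> t t0; have w0 := @omega_ge0 _ M t hM.
(* If [h * t <= 1], the left side vanishes; otherwise powers of [h * t] increase with the exponent,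
   as the bound on the remainder requires. *)
have [ht|/ltW ht] := lerP (h * t) 1.
  by rewrite omega_le1// addr_ge0// ?mulr_ge0// addr_ge0.
have {}t0 : 0 < t by rewrite -(pmulr_rgt0 _ h0) (lt_le_trans ltr01).
(* One [L] in the slope is spent on the multiple of [L], the other on the remainder. *)
apply: (@le_trans _ _ ((2 * L)%:R * omega M t + ln B)); last first.
  have := ler0n R (2 * L); move: (_%:R) (omega _ _) w0 => x w w0 x0; nra.
apply/omega_le => [//||q]; first exact: mulr_gt0.
rewrite expRD lnK ?posrE// expRM_natl mul2n -addnn exprD.
set e := expR _; have e0 : 0 < e by apply: expR_gt0.
have ht0 : 0 <= h * t by rewrite ltW// mulr_gt0.
have eM0 k : 0 <= e * M k by rewrite ltW// mulr_gt0.
have multiple : (h * t) ^+ (L * (q %/ L)) <= e ^+ L * A * M q.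
  rewrite exprMn [t ^+ _]exprM exprAC.
  apply: (@le_trans _ _ (h ^+ (L * (q %/ L)) * (e * M (q %/ L)%N) ^+ L)).
    rewrite ler_pM2l ?exprn_gt0// lerXn2r ?nnegrE//.
      by rewrite exprn_ge0 ?ltW.
    exact: expr_le_omega.
  rewrite exprMn mulrCA -mulrA ler_pM2l ?exprn_gt0// mulrC.
  apply: le_trans (hA _) _; rewrite ler_pM2l//.
  by apply: LC_nondecreasing; rewrite // mulnC leq_divM.
have remainder : (h * t) ^+ (q %% L) <= (h * (e * M 1)) ^+ L.
  apply: (@le_trans _ _ ((h * t) ^+ L)).
    by rewrite ler_weXn2l// ltnW// ltn_mod.
  apply: lerXn2r; rewrite ?nnegrE ?(mulr_ge0 (ltW h0) (eM0 1))// ler_pM2l//.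
  exact: (@expr_le_omega _ M t 1).
rewrite {1}(divn_eq q L) mulnC exprD.
apply: le_trans (ler_pM _ _ multiple remainder) _; rewrite ?exprn_ge0//.
by rewrite /B !exprMn le_eqVlt; apply/orP; left; apply/eqP; ring.
Qed.

(* Evaluating at [h s], where [s] maximizes [s ^+ p / M p], so that
   [expR (omega M s)] equals [s ^+ p / M p]. *)
Lemma dilation_root_growth (R : realType) (M : nat -> R) (h : R) :
  LC M -> 0 < h -> dilation_le (omega M) h ->
  exists2 L : nat, (0 < L)%N & root_growth M L h.
Proof.
move=> hM h0 [L' L'1 hL']; have M0 k := @LC_gt0 _ M k hM.
pose L := (Num.bound L').+1.
have LL : L' <= L%:R by rewrite (le_trans (ltW (unstable.ltr_bound _)))// ler_nat.
exists L => //; exists (expR L%:R); first by rewrite -expR0 ler_expR.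
move=> p; set s := M p.+1 / M p; have s0 : 0 < s by apply: divr_gt0.
have ws : expR (omega M s) <= s ^+ p / M p.
  have sp0 : 0 < s ^+ p / M p by rewrite divr_gt0 ?exprn_gt0.
  rewrite -[leRHS]lnK ?posrE// ler_expR; apply/omega_le => // q.
  rewrite lnK ?posrE// -ler_pdivrMr//; exact: LC_quotient_max.
have hws : omega M (h * s) <= L%:R * omega M s + L%:R.
  apply: le_trans (hL' s (ltW s0)) _.
  by apply: lerD => //; apply: ler_wpM2r; [exact: omega_ge0|].
have main : h ^+ (L * p) * s ^+ (L * p) <=
    (s ^+ p / M p) ^+ L * expR L%:R * M (L * p)%N.
  rewrite -exprMn (le_trans ((omega_le _ hM (mulr_gt0 h0 s0)).1 hws _))//.
  rewrite expRD expRM_natl ler_pM2r// ler_pM2r ?expR_gt0//.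
  by apply: lerXn2r; rewrite // nnegrE ?expR_ge0// divr_ge0 ?exprn_ge0// ltW.
(* Multiplying the goal by [s ^+ (L * p)] and [main] by [M p ^+ L] makes the two inequalities
   coincide. *)
rewrite -(ler_pM2l (exprn_gt0 (L * p) s0)) mulrCA [s ^+ _ * _]mulrC.
rewrite -(ler_pM2l (exprn_gt0 L (M0 p))) in main.
apply: le_trans main _; rewrite le_eqVlt; apply/orP; left; apply/eqP.
rewrite expr_div_n -exprM [(p * L)%N]mulnC; field.
by rewrite expf_neq0// gt_eqF.
Qed.

(** * Forms of the dilation estimate and change of [h] *)

(** Below the threshold [T], monotonicity bounds the left side by [omega M (h * T)]. Conversely, the
    additive constant is absorbed once [omega M t >= 1]. *)
Lemma dilation_bigO_le (R : realType) (M : nat -> R) (h : R) : LC M -> 0 < h ->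
  dilation_bigO (omega M) h <-> dilation_le (omega M) h.
Proof.
move=> hM h0; have w0 t := @omega_ge0 _ M t hM; split.
  move=> /eqO_exP[k k0 [T [_ hT]]].
  have k1 : 1 <= 1 + k by rewrite lerDl ltW.
  exists (1 + k + omega M (h * T)); first by rewrite (le_trans k1)// lerDl.
  move=> t t0; have [tT|Tt] := lerP t T.
    apply: (@le_trans _ _ (omega M (h * T))).
      by apply: omega_le_mono => //; rewrite ler_pM2l.
    have := w0 (h * T); have := w0 t; have : 0 <= 1 + k by lra.
    move: (omega M t) (omega M (h * T)) => x y; nra.
  have := hT t Tt; rewrite !ger0_norm// => /le_trans; apply.
  have := w0 (h * T); have := w0 t.
  move: (omega M t) (omega M (h * T)) => x y; nra.
move=> [k k1 hk]; apply/eqO_exP; exists (k + k); first lra.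
(* Beyond this threshold [omega M t >= 1], because [t <= expR (omega M t) * M 1]. *)
have e0 : 0 < expR 1 * M 1 by rewrite mulr_gt0 ?expR_gt0// LC_gt0.
exists (expR 1 * M 1); split; first exact: gtr0_real.
move=> t et; have t0 := lt_trans e0 et; rewrite !ger0_norm//.
apply: le_trans (hk t (ltW t0)) _; rewrite mulrDl lerD2l ler_peMr//; first lra.
rewrite -ler_expR -(ler_pM2r (LC_gt0 1 hM)) (le_trans (ltW et))//.
exact: (@expr_le_omega _ M t 1).
Qed.

Lemma dilation_le_exp (R : realType) (M : nat -> R) (h : R) (n : nat) :
  LC M -> 0 <= h -> dilation_le (omega M) h -> dilation_le (omega M) (h ^+ n).
Proof.
move=> hM h0 hd; have w0 t := @omega_ge0 _ M t hM.
elim: n => [|n [k k1 hk]].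
  by exists 1 => // t _; rewrite expr0 !mul1r lerDl.
case: hd => l l1 hl; exists (l * k + l).
  by rewrite -[leLHS]addr0 lerD ?mulr_ege1// (le_trans ler01).
move=> t t0; rewrite exprS -mulrA.
apply: le_trans (hl _ _) _; first by rewrite mulr_ge0 ?exprn_ge0.
have := hk t t0; have := w0 t; move: (omega M t) (omega M (h ^+ n * t)) => x y; nra.
Qed.

(** Some power of [h] exceeds 2, and [omega M] is monotone. *)
Lemma dilation_omega1 (R : realType) (M : nat -> R) (h : R) :
  LC M -> 1 < h -> dilation_le (omega M) h -> omega1 (omega M).
Proof.
move=> hM h1 hd; apply/dilation_bigO_le => //.
have [N /(_ N (leqnn N)) hN] := expn_unbounded 2 h1.
have [k k1 hk] := dilation_le_exp N hM (ltW (lt_trans ltr01 h1)) hd.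
exists k => // t t0; apply: le_trans (hk t t0).
by apply: omega_le_mono => //; rewrite ler_wpM2r.
Qed.

Unset Implicit Arguments.

Theorem theorem3p1 (R : realType) (M : nat -> R) (hM : LC M) :
  [/\ [<-> exists (L : nat) (h : R), [/\ (0 < L)%N, 1 < h & root_growth M L h];
           exists L : nat, (0 < L)%N /\ (1%:E < root_liminf M L)%E;
           exists h : R, 1 < h /\ dilation_bigO (omega M) h;
           exists h : R, 1 < h /\ dilation_le (omega M) h;
           omega1 (omega M)],
      forall (L : nat) (h : R),
        (0 < L)%N -> 1 < h -> root_growth M L h -> (2 <= L)%N
    & forall h : R, 1 < h ->
        ((exists2 L : nat, (0 < L)%N & root_growth M L h) <->
           dilation_bigO (omega M) h) /\
        ((exists2 L : nat, (0 < L)%N & root_growth M L h) <->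
           dilation_le (omega M) h)].
Proof.
have pos (h : R) : 1 < h -> 0 < h by apply: lt_trans.
have same_h h : 1 < h -> (exists2 L : nat, (0 < L)%N & root_growth M L h) <->
    dilation_le (omega M) h.
  move=> h1; split; last exact: dilation_root_growth (pos _ h1).
  by case=> L L0; apply: root_growth_dilation h1.
split.
- tfae.
  + by move=> [L [h [L0 h1 hg]]]; exists L; split=> //; apply: root_growth_liminf hg.
  + move=> [L [L0 /(liminf_root_growth hM L0)[h h1 hg]]]; exists h; split=> //.
    apply/(dilation_bigO_le hM (pos _ h1)); exact: root_growth_dilation hg.
  + by move=> [h [h1 hd]]; exists h; split=> //; apply/(dilation_bigO_le hM (pos _ h1)).
  + by move=> [h [h1]]; apply: dilation_omega1.
  (* The cycle closes by taking [h = 2] in the equivalence for fixed [h]. *)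
  + move=> /(dilation_bigO_le hM (ltr0n _ 2)) h2.
    have [L L0 hg] := (same_h _ (ltr1n _ 2)).2 h2.
    by exists L, 2; split=> //; rewrite ltr1n.
- by move=> L h; apply: root_growth_ge2.
- move=> h h1; split; last exact: same_h.
  by apply: iff_trans (same_h _ h1) (iff_sym (dilation_bigO_le hM (pos _ h1))).
Qed.
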